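(* Let $T$ be a continuous t-norm and $A=[a_{ij}]\in[0,1]^{n\times m}$. Define $F:[0,1]^{n\times1}\to[0,1]^{n\times1}$ by $$F(c)_i=\max_{1\le j\le m}T\big(a_{ij},\min_{1\le k\le n}\mathcal I_T(a_{kj},c_k)\big),\qquad 1\le i\le n.$$ Then: 1. For all $c\in[0,1]^{n\times1}$, $F(c)\le c$. 2. For any $c\in[0,1]^{n\times1}$, $F(c)=c$ if and only if the system $A\,\Box_T^{\max}\,x=c$ is consistent. 3. $F$ is idempotent, i.e. $F(F(c))=F(c)$ for all $c\in[0,1]^{n\times1}$. 4. $F$ is increasing and right-continuous.
   Context: A t-norm is a map $T:[0,1]\times[0,1]\to[0,1]$ that is commutative, associative, increasing (in the wide sense) in the second variable and satisfies $T(x,1)=x$. Its residual implicator is $\mathcal I_T(x,y)=\sup\{z\in[0,1]\mid T(x,z)\le y\}$ for $x,y\in[0,1]$. $n,m\ge1$ are integers. For $c=[c_i]\in[0,1]^{n\times1}$, the system $A\,\Box_T^{\max}\,x=c$ is: find $x=[x_j]\in[0,1]^{m\times1}$ with $\max_{1\le j\le m}T(a_{ij},x_j)=c_i$ for all $i\in\{1,\dots,n\}$; it is consistent if such an $x$ exists. The order $\le$ on $[0,1]^{n\times1}$ is componentwise. ''Increasing'' is in the wide sense: $c\le c'$ implies $F(c)\le F(c')$. ''$F$ is right-continuous at $c\in[0,1]^{n\times1}$'' means: for any sequence $(c^{(k)})$ in $[0,1]^{n\times1}$ converging to $c$ with $c^{(k)}\ge c$ for all $k$, one has $F(c^{(k)})\to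 F(c)$ as $k\to\infty$; $F$ is right-continuous if this holds at every $c$. *)

(* Defs.v *)
From mathcomp Require Import all_boot all_order all_algebra.
From mathcomp Require Import all_classical all_reals all_analysis.
Set Implicit Arguments.
Unset Strict Implicit.
Unset Printing Implicit Defensive.
Import Order.TTheory GRing.Theory Num.Theory.
Import numFieldNormedType.Exports.
Local Open Scope classical_set_scope.
Local Open Scope ring_scope.

(* Operations on [0,1] are represented by total functions on R which are only
   constrained, and only used, on [0,1]. *)

Record is_tnorm (R : realType) (T : R -> R -> R) : Prop := IsTnorm {
  tnorm_in01 : forall x y : R, x \in `[0, 1] -> y \in `[0, 1] ->
    T x y \in `[0, 1];
  tnorm_comm : forall x y : R, x \in `[0, 1] -> y \in `[0, 1] ->
    T x y = T y x;
  tnorm_assoc : forall x y z : R,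
    x \in `[0, 1] -> y \in `[0, 1] -> z \in `[0, 1] ->
    T x (T y z) = T (T x y) z;
  tnorm_incr : forall x y z : R,
    x \in `[0, 1] -> y \in `[0, 1] -> z \in `[0, 1] ->
    y <= z -> T x y <= T x z;
  tnorm_x1 : forall x : R, x \in `[0, 1] -> T x 1 = x
}.

Definition continuous_on_square (R : realType) (T : R -> R -> R) : Prop :=
  {within `[0, 1]%classic `*` `[0, 1]%classic,
    continuous (fun p : R * R => T p.1 p.2)}.

Definition residual_implicator (R : realType) (T : R -> R -> R) (x y : R) : R :=
  sup [set z : R | z \in `[0, 1] /\ T x z <= y].

Definition unit_cube (R : realType) (n m : nat) : set 'M[R]_(n, m) :=
  [set M : 'M[R]_(n, m) | forall i j, M i j \in `[0, 1]].

Definition cv_le (R : realType) (n : nat) (c d : 'cV[R]_n) : Prop :=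
  forall i, c i 0 <= d i 0.

(* The neutral values 0 (for max) and 1 (for min) in the iterated operations
   below are irrelevant: the index ranges are nonempty and all the terms lie
   in [0,1]. *)

Definition max_comp (R : realType) (T : R -> R -> R) (n m : nat)
    (A : 'M[R]_(n, m)) (x : 'cV[R]_m) : 'cV[R]_n :=
  \col_(i < n) \big[Num.max/0]_(j < m) T (A i j) (x j 0).

Definition consistent (R : realType) (T : R -> R -> R) (n m : nat)
    (A : 'M[R]_(n, m)) (c : 'cV[R]_n) : Prop :=
  exists x : 'cV[R]_m, unit_cube x /\ max_comp T A x = c.

Definition F (R : realType) (T : R -> R -> R) (n m : nat)
    (A : 'M[R]_(n, m)) (c : 'cV[R]_n) : 'cV[R]_n :=
  \col_(i < n) \big[Num.max/0]_(j < m)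
    T (A i j)
      (\big[Num.min/1]_(k < n) residual_implicator T (A k j) (c k 0)).

Definition increasing_on_cube (R : realType) (n : nat)
    (G : 'cV[R]_n -> 'cV[R]_n) : Prop :=
  forall c d, unit_cube c -> unit_cube d -> cv_le c d -> cv_le (G c) (G d).

Definition right_continuous_at (R : realType) (n : nat)
    (G : 'cV[R]_n -> 'cV[R]_n) (c : 'cV[R]_n) : Prop :=
  forall u : nat -> 'cV[R]_n,
    (forall k, unit_cube (u k)) -> (forall k, cv_le c (u k)) ->
    u k @[k --> \oo] --> c -> G (u k) @[k --> \oo] --> G c.

Definition right_continuous_on_cube (R : realType) (n : nat)
    (G : 'cV[R]_n -> 'cV[R]_n) : Prop :=
  forall c, unit_cube c -> right_continuous_at G c.

(* Main.v *)
Require Import Defs.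
From mathcomp Require Import all_boot all_order all_algebra.
From mathcomp Require Import all_classical all_reals all_analysis.
Import Order.TTheory GRing.Theory Num.Theory.
Import numFieldNormedType.Exports.
Local Open Scope classical_set_scope.
Local Open Scope ring_scope.

(** Continuity of [T] makes the supremum defining the residual implicator a
    maximum, so that [T x z <= y <-> z <= I x y]. Hence [A x <= c] iff
    [x <= x*(c)], where [x*(c)_j] is the minimum of the [I (a_kj) (c_k)], and
    [F c = A x*(c)] is the largest vector of the form [A x] below [c]; parts 1
    to 3 and monotonicity follow. The adjunction also makes [I x] continuous
    from the right, since [y < T x z] forces [I x y' < z] as soon as
    [y' < T x z]. *)

(** * Residuation for a continuous t-norm *)

Section ContinuousTnorm.
Context {R : realType} {T : R -> R -> R}.
Hypotheses (T_tnorm : is_tnorm T) (T_cont : continuous_on_square T).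

Lemma tnorm_x0 (x : R) : x \in `[0, 1] -> T x 0 = 0.
Proof.
move=> x01; have i0 : (0 : R) \in `[0, 1] by rewrite in_itv /= lexx ler01.
have i1 : (1 : R) \in `[0, 1] by rewrite in_itv /= lexx ler01.
apply/eqP; rewrite eq_le; apply/andP; split; last first.
  by have /itvP-> := tnorm_in01 T_tnorm x01 i0.
(* The bound is [T x 0 = T 0 x <= T 0 1 = 0]. *)
rewrite (tnorm_comm T_tnorm)// -[leRHS](tnorm_x1 T_tnorm)//.
by apply: (tnorm_incr T_tnorm) => //; rewrite (itvP x01).
Qed.

(** Continuity is only relative to the square, so [u] must eventually stay in [[0, 1]]. The filter
    is arbitrary in order to cover both sequences and neighbourhoods within [[0, 1]]. *)
Lemma cvg_tnorm {I : Type} {D : set_system I} {FD : Filter D} (u : I -> R)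
    (x l : R) : x \in `[0, 1] -> l \in `[0, 1] ->
  (\forall k \near D, u k \in `[0, 1]) ->
  u k @[k --> D] --> l -> T x (u k) @[k --> D] --> T x l.
Proof.
move=> x01 l01 u01 ul.
have sq_xl : (`[0, 1]%classic `*` `[0, 1]%classic) (x, l) by split.
have xul : (x, u k) @[k --> D] --> (x, l).
  exact: (cvg_pair (FG := nbhs_filter x) (FH := nbhs_filter l) (cvg_cst x) ul).
have xul_sub : (x, u k) @[k --> D] -->
    ((x, l) : subspace (`[0, 1]%classic `*` `[0, 1]%classic)).
  apply/subspace_cvgP => // V /= VA.
  have := xul _ VA; apply: filterS2 u01 => k uk.
  by apply; split.
exact: (cvg_comp _ _ xul_sub (T_cont (x, l))).
Qed.

Let residual_set (x y : R) := [set z : R | z \in `[0, 1] /\ T x z <= y].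

Lemma has_sup_residual_set (x y : R) : x \in `[0, 1] -> y \in `[0, 1] ->
  has_sup (residual_set x y).
Proof.
move=> x01 y01; split; last by exists 1 => z [/itvP->].
exists 0; split; first by rewrite in_itv /= lexx ler01.
by rewrite tnorm_x0// (itvP y01).
Qed.

Lemma residual_in01 (x y : R) : x \in `[0, 1] -> y \in `[0, 1] ->
  residual_implicator T x y \in `[0, 1].
Proof.
move=> x01 y01; have [ne ub] := has_sup_residual_set _ _ x01 y01.
rewrite in_itv /=; apply/andP; split; last first.
  by apply: ge_sup => // z [/itvP->].
apply: ub_le_sup => //; split; first by rewrite in_itv /= lexx ler01.
by rewrite tnorm_x0// (itvP y01).
Qed.

(** The supremum [s] is attained: if [y < T x s], continuity gives [y < T x z] for all [z] in
    [[0, 1]] close to [s], yet members of the residual set come arbitrarily close to [s]. *)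
Lemma tnorm_residual_le (x y : R) : x \in `[0, 1] -> y \in `[0, 1] ->
  T x (residual_implicator T x y) <= y.
Proof.
move=> x01 y01; set s := residual_implicator T x y.
have s01 : s \in `[0, 1] by exact: residual_in01.
rewrite leNgt; apply/negP => ys.
have Tcvg : T x z @[z --> within `[0, 1]%classic (nbhs s)] --> T x s.
  apply: cvg_tnorm => //; last exact: cvg_within.
  by apply: filterS (withinT _ _) => //.
have : nbhs s [set z | z \in `[0, 1] -> y < T x z] := cvgr_gt _ Tcvg _ ys.
rewrite -nbhs_ballE => -[e /= e0 se].
have [z [z01 Tzy] sz] := sup_adherent e0 (has_sup_residual_set _ _ x01 y01).
have zs : z <= s.
  by apply: ub_le_sup => //; have [] := has_sup_residual_set _ _ x01 y01.
have := se z; rewrite /ball /= => /(_ _ z01).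
rewrite ger0_norm ?subr_ge0// ltrBlDl -ltrBlDr sz => /(_ isT).
by rewrite ltNge Tzy.
Qed.

Lemma tnorm_residual_adjoint (x y z : R) :
  x \in `[0, 1] -> y \in `[0, 1] -> z \in `[0, 1] ->
  (T x z <= y) = (z <= residual_implicator T x y).
Proof.
move=> x01 y01 z01; apply/idP/idP => [Tzy|zI].
  by apply: ub_le_sup => //; have [] := has_sup_residual_set _ _ x01 y01.
apply: le_trans (tnorm_residual_le _ _ x01 y01).
by apply: (tnorm_incr T_tnorm) => //; exact: residual_in01.
Qed.

Lemma residual_incr (x y y' : R) :
  x \in `[0, 1] -> y \in `[0, 1] -> y' \in `[0, 1] -> y <= y' ->
  residual_implicator T x y <= residual_implicator T x y'.
Proof.
move=> x01 y01 y'01 yy'; have I01 := residual_in01 _ _ x01 y01.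
rewrite -tnorm_residual_adjoint//.
exact: le_trans (tnorm_residual_le _ _ x01 y01) yy'.
Qed.

Lemma residual_right_continuous {I : Type} {D : set_system I} {FD : Filter D}
    (u : I -> R) (x y : R) : x \in `[0, 1] -> y \in `[0, 1] ->
  (forall k, u k \in `[0, 1]) -> (forall k, y <= u k) ->
  u k @[k --> D] --> y ->
  residual_implicator T x (u k) @[k --> D] --> residual_implicator T x y.
Proof.
move=> x01 y01 u01 yu uy; set s := residual_implicator T x y.
have s01 : s \in `[0, 1] by exact: residual_in01.
have sI k : s <= residual_implicator T x (u k) by exact: residual_incr.
apply/cvgrPdist_lt => e e0.
(* The adjunction applies to [s + e] only inside [[0, 1]]; beyond 1, the bound
   [I x (u k) <= 1 < s + e] suffices. *)
have [se1|se1] := ltP 1 (s + e).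
  near=> k; rewrite ler0_norm ?subr_le0// opprB ltrBlDl.
  by apply: le_lt_trans se1; rewrite (itvP (residual_in01 _ _ x01 (u01 k))).
have se01 : s + e \in `[0, 1].
  by rewrite in_itv /= se1 andbT addr_ge0 ?(itvP s01)// ltW.
have yT : y < T x (s + e).
  by rewrite ltNge tnorm_residual_adjoint// -ltNge ltrDl.
near=> k; rewrite ler0_norm ?subr_le0// opprB ltrBlDl.
rewrite ltNge -tnorm_residual_adjoint// -ltNge.
by near: k; exact: cvgr_lt yT.
Unshelve. all: by end_near. Qed.

End ContinuousTnorm.

(** * Entrywise convergence and order of matrices *)

Lemma cvg_mx {R : realType} {n m : nat} {I : Type} {D : set_system I}
    {FD : Filter D} (u : I -> 'M[R]_(n, m)) (M : 'M[R]_(n, m)) :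
  (forall i j, u k i j @[k --> D] --> M i j) -> u k @[k --> D] --> M.
Proof.
move=> uM; apply/cvg_ballP => e e0.
near=> k; split=> //; near: k.
(* The index sets are finite, so entrywise eventual bounds hold simultaneously. *)
apply: filter_forall => i; apply: filter_forall => j.
by have /cvg_ballP := uM i j; apply.
Unshelve. all: by end_near. Qed.

Lemma cv_le_anti {R : realType} {n : nat} (c d : 'cV[R]_n) :
  cv_le c d -> cv_le d c -> c = d.
Proof.
by move=> cd dc; apply/matrixP => i j; rewrite ord1; apply/le_anti; rewrite cd dc.
Qed.

Lemma cv_le_trans {R : realType} {n : nat} (c d e : 'cV[R]_n) :
  cv_le c d -> cv_le d e -> cv_le c e.
Proof. by move=> cd de i; exact: le_trans (cd i) (de i). Qed.

(** * The max-T system and the operator [F] *)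

Section System.
Context {R : realType} {T : R -> R -> R} {n m : nat} {A : 'M[R]_(n, m)}.
Hypotheses (T_tnorm : is_tnorm T) (T_cont : continuous_on_square T).
Hypothesis A01 : unit_cube A.

Definition greatest_subsolution (c : 'cV[R]_n) : 'cV[R]_m :=
  \col_(j < m) \big[Num.min/1]_(k < n) residual_implicator T (A k j) (c k 0).

Lemma F_max_comp (c : 'cV[R]_n) :
  F T A c = max_comp T A (greatest_subsolution c).
Proof.
by apply/matrixP => i j; rewrite !mxE; apply: eq_bigr => k _; rewrite !mxE.
Qed.

Lemma greatest_subsolution_in_cube (c : 'cV[R]_n) :
  unit_cube c -> unit_cube (greatest_subsolution c).
Proof.
move=> c01 j k; rewrite mxE; apply: (big_ind (fun z : R => z \in `[0, 1])).
- by rewrite in_itv /= lexx ler01.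
- by move=> x y x01 y01; case: (leP x y).
- by move=> i _; exact: residual_in01 T_tnorm _ _ (A01 i j) (c01 i 0).
Qed.

Lemma max_comp_in_cube (x : 'cV[R]_m) :
  unit_cube x -> unit_cube (max_comp T A x).
Proof.
move=> x01 i j; rewrite mxE; apply: (big_ind (fun z : R => z \in `[0, 1])).
- by rewrite in_itv /= lexx ler01.
- by move=> y z y01 z01; case: (leP y z).
- by move=> k _; exact: (tnorm_in01 T_tnorm (A01 i k) (x01 k 0)).
Qed.

Lemma max_comp_incr (x y : 'cV[R]_m) : unit_cube x -> unit_cube y ->
  cv_le x y -> cv_le (max_comp T A x) (max_comp T A y).
Proof.
move=> x01 y01 xy i; rewrite !mxE; apply: le_bigmax2 => j _.
exact: (tnorm_incr T_tnorm (A01 i j) (x01 j 0) (y01 j 0) (xy j)).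
Qed.

(** Both sides amount to [T (A k j) (x j 0) <= c k 0] for all [k] and [j], by the scalar
    adjunction. *)
Lemma max_comp_le_adjoint (c : 'cV[R]_n) (x : 'cV[R]_m) :
  unit_cube c -> unit_cube x ->
  cv_le (max_comp T A x) c <-> cv_le x (greatest_subsolution c).
Proof.
move=> c01 x01; split=> [Axc j|xc i]; rewrite mxE.
  (* The neutral value 1 of the minimum must also dominate [x j 0]; dually, the neutral value 0 of
     the maximum must lie below [c i 0] in the converse. *)
  apply: le_bigmin => [|k _]; first by rewrite (itvP (x01 j 0)).
  rewrite -(tnorm_residual_adjoint T_tnorm T_cont _ _ _ (A01 k j) (c01 k 0))//.
  apply: le_trans (Axc k).
  by rewrite mxE; exact: (le_bigmax _ (fun j => T (A k j) (x j 0))).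
apply: bigmax_le => [|j _]; first by rewrite (itvP (c01 i 0)).
rewrite (tnorm_residual_adjoint T_tnorm T_cont _ _ _ (A01 i j) (c01 i 0))//.
apply: le_trans (xc j) _.
by rewrite mxE; exact: bigmin_le.
Qed.

Lemma F_in_cube (c : 'cV[R]_n) : unit_cube c -> unit_cube (F T A c).
Proof.
move=> c01; rewrite F_max_comp; apply: max_comp_in_cube.
exact: greatest_subsolution_in_cube.
Qed.

Lemma F_le (c : 'cV[R]_n) : unit_cube c -> cv_le (F T A c) c.
Proof.
move=> c01; rewrite F_max_comp; apply/max_comp_le_adjoint => //.
exact: greatest_subsolution_in_cube.
Qed.

Lemma F_consistent (c : 'cV[R]_n) : unit_cube c -> consistent T A (F T A c).
Proof.
move=> c01; exists (greatest_subsolution c); rewrite F_max_comp; split=> //.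
exact: greatest_subsolution_in_cube.
Qed.

(** Values of [F] are always consistent. Conversely, a solution [x] lies below
    [greatest_subsolution c], so [c = A x <= F c <= c]. *)
Lemma F_fixpoint (c : 'cV[R]_n) :
  unit_cube c -> F T A c = c <-> consistent T A c.
Proof.
move=> c01; split=> [<-|[x [x01 Axc]]]; first exact: F_consistent.
apply: cv_le_anti; first exact: F_le.
have Ax_le : cv_le (max_comp T A x) c by rewrite Axc => i.
rewrite F_max_comp -[X in cv_le X _]Axc.
apply: max_comp_incr; [exact: x01|exact: greatest_subsolution_in_cube|].
exact/max_comp_le_adjoint.
Qed.

Lemma F_incr : increasing_on_cube (F T A).
Proof.
move=> c d c01 d01 cd; rewrite !F_max_comp; apply: max_comp_incr;
  try exact: greatest_subsolution_in_cube.
(* By adjunction it is enough that [F c <= d], which follows from [F c <= c <= d]. *)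
apply/max_comp_le_adjoint => //; first exact: greatest_subsolution_in_cube.
by rewrite -F_max_comp; apply: cv_le_trans cd; exact: F_le.
Qed.

(** Finite maxima and minima and [T] pass to limits from any side; only the residual implicator
    needs the entries of [u k] to stay above those of [c]. *)
Lemma F_right_continuous : right_continuous_on_cube (F T A).
Proof.
move=> c c01 u u01 cu uc; rewrite F_max_comp.
under eq_cvg do rewrite F_max_comp.
apply: cvg_mx => i j; rewrite ord1 mxE; under eq_cvg do rewrite mxE.
apply: cvg_big; first exact: max_continuous.
move=> k _; apply: cvg_tnorm => //.
- exact: greatest_subsolution_in_cube.
- by near=> l; exact: greatest_subsolution_in_cube.
rewrite mxE; under eq_cvg do rewrite mxE.
apply: cvg_big; first exact: min_continuous.
move=> l _; apply: residual_right_continuous => //.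
- by move=> p; exact: u01.
- by move=> p; exact: cu.
- exact: (cvg_comp _ _ uc (@coord_continuous _ _ _ l 0 c)).
Unshelve. all: by end_near. Qed.

End System.

Theorem proposition1 (R : realType) (T : R -> R -> R) (n m : nat)
    (A : 'M[R]_(n, m)) (n_gt0 : (0 < n)%N) (m_gt0 : (0 < m)%N)
    (T_tnorm : is_tnorm T) (T_cont : continuous_on_square T)
    (A01 : unit_cube A) :
  (forall c : 'cV[R]_n, unit_cube c -> unit_cube (F T A c)) /\
  (forall c : 'cV[R]_n, unit_cube c -> cv_le (F T A c) c) /\
  (forall c : 'cV[R]_n, unit_cube c ->
     (F T A c = c <-> consistent T A c)) /\
  (forall c : 'cV[R]_n, unit_cube c -> F T A (F T A c) = F T A c) /\
  (increasing_on_cube (F T A) /\ right_continuous_on_cube (F T A)).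
Proof.
split; first exact: F_in_cube.
split; first exact: F_le.
split; first exact: F_fixpoint.
split; last by split; [exact: F_incr|exact: F_right_continuous].
(* Idempotence is the fixed point criterion applied to the consistent vector [F T A c]. *)
move=> c c01; apply/(F_fixpoint T_tnorm T_cont A01); first exact: F_in_cube.
exact: F_consistent.
Qed.
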